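(* For every real $\xi>0$ and every $\theta\in[0,\pi/5]$, with $u=e^{i\theta}$, the number $$y_1=\sqrt[5]{2\xi+\frac{2u^2}{5}t_0^3+\frac{2u^3}{25}t_0^2+\frac{u^4}{125}t_0+\frac{u^5}{3125}}-\frac{u}{5},\qquad t_0=\sqrt[4]{\frac{2\xi}{u+(\xi/\alpha)^{2/9}}},\qquad \alpha=\sqrt{\frac{2+\sqrt2}{4}},$$ satisfies $$\left|\frac{y_1}{y^*}-1\right|\le C_1,\qquad C_1=2.51\times 10^{-2},$$ where $y^*$ is the distinguished root of $\frac{y^5+uy^4}{2}=\xi$ defined in the context.
   Context: Convention: the $n$-th root of a complex number is the one whose argument lies in $[-\pi/n,\pi/n[$; $(\xi/\alpha)^{2/9}$ is a positive real number. Distinguished root $y^*$: for $\xi>0$, $\theta\in\,]0,\pi/5]$ and $u=e^{i\theta}$, the equation $\frac{y^5+uy^4}{2}=\xi$ has exactly one root of the form $re^{i\sigma}$ with $r>0$ and $\sigma\in[-\theta/4,0[$; this root is called $y^*$. For $\theta=0$ (so $u=1$), $y^*$ is the unique positive real root of the equation. *)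

(* Defs.v *)
(* Stdlib reals, with Coquelicot's complex numbers. *)
From Stdlib Require Export Reals ClassicalEpsilon.
From Coquelicot Require Export Coquelicot.
Open Scope R_scope.

(* The complex number e^{i t}, for t real. *)
Definition expi (t : R) : C := (cos t, sin t).

(* w is the n-th root of z whose argument lies in [-pi/n, pi/n[.  The modulus
   r is allowed to be 0, so that 0 is the n-th root of 0. *)
Definition is_nth_root (n : nat) (z w : C) : Prop :=
  (w ^ n)%C = z /\
  exists r s : R,
    0 <= r /\ - PI / INR n <= s < PI / INR n /\ w = (RtoC r * expi s)%C.

(* For n > 0 exactly one w satisfies [is_nth_root n z w]. *)
Definition nth_root (n : nat) (z : C) : C :=
  epsilon (inhabits (RtoC 0)) (is_nth_root n z).

(* The distinguished root y* of (y^5 + u y^4) / 2 = xi with u = e^{i theta}.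
   At theta = 0 the sector [-theta/4, 0[ is empty and the positive real root
   is taken instead. *)
Definition is_ystar (xi theta : R) (y : C) : Prop :=
  ((y ^ 5 + expi theta * y ^ 4) / RtoC 2)%C = RtoC xi /\
  (0 < theta ->
     exists r s : R,
       0 < r /\ - theta / 4 <= s < 0 /\ y = (RtoC r * expi s)%C) /\
  (theta = 0 -> exists r : R, 0 < r /\ y = RtoC r).

(* For xi > 0 and 0 <= theta <= pi/5 exactly one y satisfies
   [is_ystar xi theta y]. *)
Definition ystar (xi theta : R) : C :=
  epsilon (inhabits (RtoC 0)) (is_ystar xi theta).

(* Main.v *)
(* Write the distinguished root as y = r e^{-i phi}, 0 <= phi <= theta / 4, and put
   x = (xi / alpha)^{2/9}.  The imaginary part of y^4 (y + u) = 2 xi gives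
   r sin (5 phi) = sin (theta - 4 phi), so r phi is small, and its modulus squeezes x
   between r and a slight multiple of r.  Hence t0 = y z with z^4 = (y + u) / (u + x)
   close to 1 unless r is large.  With V = y + u/5 the radicand of y1 is
   V^5 + (g t0 - g y), where g t = (t + u/5)^5 - t^5 - u t^4 has degree 3: for large r
   this damps the error of t0 by a factor of order 1 / r^2.  So the radicand is
   V^5 (1 + eps) with eps small, and y1 = V (1 + eps)^{1/5} - u/5, provided
   V (1 + eps)^{1/5} lies in the sector of the principal fifth root.  It does, being
   u/5 plus a small perturbation of y, although u/5 itself is on the boundary of that
   sector when theta = pi/5. *)
Require Import Defs.
From Stdlib Require Import Lra Lia.

(** * Taylor bounds for sine and cosine, and bounds for pi *)

Lemma sin_lower (x : R) : 0 <= x <= 4 -> x - x ^ 3 / 6 <= sin x.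
Proof.
  intros Hx.
  destruct (pre_sin_bound x 0 ltac:(lra) ltac:(lra)) as [H _].
  unfold sin_approx, sin_term in H; simpl in H; lra.
Qed.

Lemma sin_upper (x : R) : 0 <= x -> sin x <= x.
Proof.
  intros [Hx | <-]; [left; now apply sin_lt_x | rewrite sin_0; lra].
Qed.

Lemma cos_lower (x : R) : -2 <= x <= 2 -> 1 - x ^ 2 / 2 <= cos x.
Proof.
  intros Hx.
  destruct (pre_cos_bound x 0 ltac:(lra) ltac:(lra)) as [H _].
  unfold cos_approx, cos_term in H; simpl in H; lra.
Qed.

(** The degree-four Taylor polynomial of cosine is negative at 1.6, whereas cosine is nonnegative up
    to [PI / 2]. *)
Lemma PI_lt_3_2 : PI < 32 / 10.
Proof.
  assert (H : cos (16 / 10) < 0).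
  { destruct (pre_cos_bound (16 / 10) 0 ltac:(lra) ltac:(lra)) as [_ H].
    unfold cos_approx, cos_term in H; simpl in H; lra. }
  destruct (Rlt_or_le PI (32 / 10)) as [h | h]; [exact h |].
  assert (0 <= cos (16 / 10)) by (apply cos_ge_0; lra).
  lra.
Qed.

Lemma PI_gt_3 : 3 < PI.
Proof. generalize PI2_3_2; lra. Qed.

Lemma pow_le_inv (n : nat) (x y : R) : 0 <= y -> x ^ S n <= y ^ S n -> x <= y.
Proof.
  intros Hy H.
  destruct (Rle_or_lt x y) as [h | h]; [exact h |].
  assert (y ^ S n < x ^ S n); [clear H | lra].
  induction n as [| n IH]; [simpl; lra |].
  change (y * y ^ S n < x * x ^ S n).
  assert (0 <= y ^ S n) by now apply pow_le.
  nra.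
Qed.

(** * Polar form, and uniqueness of the root with argument in the prescribed sector *)

Lemma C_eq (z w : C) : Re z = Re w -> Im z = Im w -> z = w.
Proof. destruct z, w; unfold Re, Im; simpl; intros; subst; reflexivity. Qed.

Lemma expi_add (a b : R) : expi (a + b) = (expi a * expi b)%C.
Proof.
  apply C_eq; unfold expi, Re, Im; simpl; [rewrite cos_plus | rewrite sin_plus]; ring.
Qed.

Lemma expi_0 : expi 0 = RtoC 1.
Proof. unfold expi; rewrite cos_0, sin_0; reflexivity. Qed.

Lemma expi_pow (a : R) (n : nat) : (expi a ^ n)%C = expi (INR n * a).
Proof.
  induction n as [| n IH]; [simpl; rewrite Rmult_0_l, expi_0; reflexivity |].
  rewrite Cpow_S, IH, <- expi_add, S_INR; f_equal; ring.
Qed.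

Lemma Cmod_polar2 (r a : R) : Cmod (RtoC r * expi a)%C ^ 2 = r ^ 2.
Proof.
  rewrite Cmod2_alt; unfold expi, Re, Im; simpl.
  generalize (sin2_cos2 a); unfold Rsqr; nra.
Qed.

Lemma Cmod_polar (r a : R) : 0 <= r -> Cmod (RtoC r * expi a)%C = r.
Proof.
  intros Hr; apply Rle_antisym; apply (pow_le_inv 1); try apply Cmod_ge_0; auto;
    rewrite Cmod_polar2; lra.
Qed.

Lemma Cmod_expi (a : R) : Cmod (expi a) = 1.
Proof.
  rewrite <- (Cmod_polar 1 a) by lra; f_equal; ring.
Qed.

Lemma Re_le_Cmod (z : C) : - Cmod z <= Re z <= Cmod z.
Proof. apply Rabs_le_between, re_le_Cmod. Qed.

Lemma Im_le_Cmod (z : C) : - Cmod z <= Im z <= Cmod z.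
Proof. 
  apply Rabs_le_between.
  eapply Rle_trans; [apply Rmax_r | apply (Rmax_Cmod z)].
Qed.

Lemma expi_minus_1 (a : R) : 0 <= a <= 2 -> Cmod (expi a - 1) <= a.
Proof.
  intros Ha; apply (pow_le_inv 1); [lra |].
  rewrite Cmod2_alt; unfold expi, Re, Im; simpl.
  generalize (sin2_cos2 a) (cos_lower a ltac:(lra)); unfold Rsqr; nra.
Qed.

Lemma expi_inj (a b : R) : - PI <= a < PI -> - PI <= b < PI -> expi a = expi b -> a = b.
Proof.
  intros Ha Hb H; injection H as Hc Hs.
  assert (Hcos : cos (a - b) = 1).
  { rewrite cos_minus, Hc, Hs; generalize (sin2_cos2 b); unfold Rsqr; lra. }
  assert (Hsin : sin ((a - b) / 2) = 0).
  { replace (a - b) with (2 * ((a - b) / 2)) in Hcos by lra.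
    rewrite cos_2a_sin in Hcos; nra. }
  destruct (Rtotal_order a b) as [h | [h | h]]; [| exact h |].
  - assert (0 < sin (- ((a - b) / 2))) by (apply sin_gt_0; lra).
    rewrite sin_neg in *; lra.
  - assert (0 < sin ((a - b) / 2)) by (apply sin_gt_0; lra); lra.
Qed.

(** The n-th powers determine the modulus. The arguments then agree because multiplication by n
    carries [-pi/n, pi/n[ into [-pi, pi[, where [expi] is injective. *)
Lemma is_nth_root_unique (n : nat) (z w1 w2 : C) :
  (0 < n)%nat -> is_nth_root n z w1 -> is_nth_root n z w2 -> w1 = w2.
Proof.
  intros Hn [P1 (r1 & s1 & R1 & S1 & E1)] [P2 (r2 & s2 & R2 & S2 & E2)].
  assert (Hn' : 0 < INR n) by now apply lt_0_INR.
  assert (Hr : r1 = r2).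
  { assert (H : Cmod w1 ^ n = Cmod w2 ^ n) by (rewrite <- !Cmod_pow, P1, P2; reflexivity).
    rewrite E1, E2, !Cmod_polar in H by assumption.
    destruct n as [| n]; [lia |].
    apply Rle_antisym; apply (pow_le_inv n); lra. }
  subst r2 w1 w2.
  (* A zero modulus makes both roots 0, whatever their arguments. *)
  destruct R1 as [R1 | <-]; [| now rewrite !Cmult_0_l].
  rewrite !Cpow_mult_l, !expi_pow in *.
  do 2 f_equal.
  assert (Hi : expi (INR n * s1) = expi (INR n * s2)).
  { rewrite <- P2 in P1.
    assert (Hp : (RtoC r1 ^ n)%C <> 0).
    { apply Cpow_nz; intro h; apply RtoC_inj in h; lra. }
    apply (f_equal (fun c => (/ (RtoC r1 ^ n) * c)%C)) in P1.
    rewrite !Cmult_assoc, !Cinv_l, !Cmult_1_l in P1 by exact Hp.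
    exact P1. }
  assert (B : forall s, - PI / INR n <= s < PI / INR n -> - PI <= INR n * s < PI).
  { intros s [h1 h2].
    apply (Rmult_le_compat_l (INR n)) in h1; [| lra].
    apply (Rmult_lt_compat_l (INR n)) in h2; [| lra].
    replace (INR n * (PI / INR n)) with PI in h2 by (field; lra).
    replace (INR n * (- PI / INR n)) with (- PI) in h1 by (field; lra).
    lra. }
  apply expi_inj in Hi; [| now apply B | now apply B].
  apply Rmult_eq_reg_l in Hi; [exact Hi | lra].
Qed.

Lemma nth_root_eq (n : nat) (z w : C) :
  (0 < n)%nat -> is_nth_root n z w -> nth_root n z = w.
Proof.
  intros Hn H; apply (is_nth_root_unique n z); auto.
  unfold nth_root; apply epsilon_spec; now exists w.
Qed.

Lemma right_half_plane_polar (w : C) :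
  0 < Re w -> exists r a, 0 < r /\ - (PI / 2) < a < PI / 2 /\ w = (RtoC r * expi a)%C.
Proof.
  intros Hw.
  pose (a := atan (Im w / Re w)).
  assert (Ha : - (PI / 2) < a < PI / 2) by (generalize (atan_bound (Im w / Re w)); unfold a; lra).
  assert (Hc : 0 < cos a) by (apply cos_gt_0; lra).
  assert (Ht : sin a / cos a = Im w / Re w) by apply tan_atan.
  exists (Re w / cos a), a; split; [now apply Rdiv_lt_0_compat | split; [exact Ha |]].
  apply C_eq; unfold expi, Re, Im in *; simpl; [field; lra |].
  apply (f_equal (fun t => t * fst w)) in Ht.
  replace (snd w / fst w * fst w) with (snd w) in Ht by (field; lra).
  rewrite <- Ht; field; lra.
Qed.

(* Multiplying by [expi (+- t)] moves one edge of the sector |arg| <= t to the real axis. *)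
Lemma sector_polar (t : R) (w : C) :
  0 < t < PI / 2 -> 0 <= Im (w * expi t) -> Im (w * expi (- t)) < 0 ->
  exists r a, 0 < r /\ - t <= a < t /\ w = (RtoC r * expi a)%C.
Proof.
  intros Ht H1 H2.
  assert (Hs : 0 < sin t) by (apply sin_gt_0; lra).
  assert (Hre : 0 < Re w).
  { unfold expi, Re, Im in *; simpl in *; rewrite cos_neg, sin_neg in H2; nra. }
  destruct (right_half_plane_polar w Hre) as (r & a & Hr & Ha & ->).
  exists r, a; split; [exact Hr | split; [| reflexivity]].
  rewrite <- Cmult_assoc, <- expi_add in H1, H2.
  unfold expi, Im in H1, H2; simpl in H1, H2.
  split.
  - destruct (Rle_or_lt (- t) a) as [h | h]; [exact h |].
    assert (0 < sin (- (a + t))) by (apply sin_gt_0; lra).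
    rewrite sin_neg in *; nra.
  - destruct (Rlt_or_le a t) as [h | h]; [exact h |].
    assert (0 <= sin (a + - t)) by (apply sin_ge_0; lra).
    nra.
Qed.

(** * Distance from 1 of the principal root of a number near 1 *)

Lemma geometric_sum (z : C) (n : nat) :
  ((z - 1) * sum_n (fun k => (z ^ k)%C) n)%C = (z ^ S n - 1)%C.
Proof.
  induction n as [| n IH].
  - rewrite sum_O; simpl; ring.
  - rewrite sum_Sn; unfold plus; simpl in *; rewrite Cmult_plus_distr_l, IH; ring.
Qed.

Lemma Re_geometric_sum_lower (z : C) (c : R) (n : nat) :
  (forall k, (1 <= k <= n)%nat -> c <= Re (z ^ k)%C) ->
  1 + INR n * c <= Re (sum_n (fun k => (z ^ k)%C) n).
Proof.
  induction n as [| n IH]; intros H.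
  - rewrite sum_O; simpl; lra.
  - rewrite sum_Sn, S_INR.
    assert (h1 := IH (fun k hk => H k ltac:(lia))).
    assert (h2 := H (S n) ltac:(lia)).
    unfold plus, Re in *; simpl in *; lra.
Qed.

Lemma pow_ge_min_1 (g c : R) (k n : nat) :
  0 < g -> (k <= n)%nat -> c <= 1 -> c <= g ^ n -> c <= g ^ k.
Proof.
  intros Hg Hk Hc Hn.
  destruct (Rle_or_lt 1 g) as [h | h].
  - apply Rle_trans with 1; [exact Hc | now apply pow_R1_Rle].
  - apply Rle_trans with (g ^ n); [exact Hn |].
    replace n with (k + (n - k))%nat by lia; rewrite pow_add.
    assert (g ^ (n - k) <= 1) by (rewrite <- (pow1 (n - k)); apply pow_incr; lra).
    assert (0 < g ^ k) by now apply pow_lt.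
    nra.
Qed.

Lemma principal_root (n : nat) (q : C) :
  0 < Re q ->
  exists g a, 0 < g /\ - (PI / 2) < INR (S n) * a < PI / 2 /\
    ((RtoC g * expi a) ^ S n)%C = q /\ g ^ S n = Cmod q.
Proof.
  intros Hq.
  destruct (right_half_plane_polar q Hq) as (r & b & Hr & Hb & ->).
  assert (Hn : 0 < INR (S n)) by (apply lt_0_INR; lia).
  assert (Hg : Rpower r (/ INR (S n)) ^ S n = r).
  { rewrite <- Rpower_pow by apply exp_pos; rewrite Rpower_mult.
    rewrite Rinv_l by lra; now apply Rpower_1. }
  exists (Rpower r (/ INR (S n))), (b / INR (S n)).
  replace (INR (S n) * (b / INR (S n))) with b by (field; lra).
  repeat split; try lra; [apply exp_pos | |].
  - rewrite Cpow_mult_l, expi_pow, <- RtoC_pow, Hg.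
    do 2 f_equal; field; lra.
  - rewrite Cmod_polar; lra.
Qed.

(** Factor z^(n+1) - 1 = (z - 1)(1 + z + ... + z^n). The powers z^k lie between 1 and q both in
    modulus and in argument, which gives Re (z^k) >= 1 - h. For small h the root thus divides the
    error by nearly n + 1. *)
Lemma principal_root_near_1 (n : nat) (q : C) (h : R) :
  0 <= h < 1 -> Cmod (q - 1) <= h ->
  exists g a, 0 < g /\ - (PI / 2) < INR (S n) * a < PI / 2 /\
    ((RtoC g * expi a) ^ S n)%C = q /\
    Cmod (RtoC g * expi a - 1) * (1 + INR n * (1 - h)) <= Cmod (q - 1).
Proof.
  intros Hh Hq.
  assert (Hre : 1 - h <= Re q).
  { generalize (Re_le_Cmod (q - 1)); unfold Re; simpl; lra. }
  destruct (principal_root n q ltac:(lra)) as (g & a & Hg & Ha & Hz & Hm).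
  exists g, a; do 3 (split; [assumption |]).
  set (z := (RtoC g * expi a)%C) in *.
  rewrite <- Hz, <- geometric_sum, Cmod_mult.
  apply Rmult_le_compat_l; [apply Cmod_ge_0 |].
  apply Rle_trans with (Re (sum_n (fun k => (z ^ k)%C) n)); [| apply Re_le_Cmod].
  apply Re_geometric_sum_lower; intros k Hk.
  assert (Hn : 0 < INR (S n)) by (apply lt_0_INR; lia).
  set (R0 := g ^ S n) in *; set (b := INR (S n) * a) in *.
  assert (HR0 : 0 < R0) by now apply pow_lt.
  assert (Hqp : q = (RtoC R0 * expi b)%C).
  { rewrite <- Hz; unfold z, R0, b.
    rewrite Cpow_mult_l, expi_pow, RtoC_pow; reflexivity. }
  assert (Hcosk : cos b <= cos (INR k * a) /\ 0 <= cos (INR k * a)).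
  { assert (Hk1 : 0 <= INR k <= INR (S n)) by (split; [apply pos_INR | apply le_INR; lia]).
    assert (Habs : INR k * Rabs a <= INR (S n) * Rabs a).
    { apply Rmult_le_compat_r; [apply Rabs_pos | lra]. }
    assert (Hb : INR (S n) * Rabs a < PI / 2).
    { unfold b in Ha; unfold Rabs; destruct (Rcase_abs a); lra. }
    assert (Hpos : 0 <= INR k * Rabs a) by (apply Rmult_le_pos; [lra | apply Rabs_pos]).
    assert (Heven : forall c, cos (INR c * a) = cos (INR c * Rabs a)).
    { intros c; unfold Rabs; destruct (Rcase_abs a); [| reflexivity].
      rewrite <- cos_neg; f_equal; ring. }
    unfold b; rewrite !Heven; split; [apply cos_decr_1; lra | apply cos_ge_0; lra]. }
  assert (Hzk : Re (z ^ k)%C = g ^ k * cos (INR k * a)).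
  { unfold z; rewrite Cpow_mult_l, expi_pow, <- RtoC_pow; unfold Re, expi; simpl; ring. }
  assert (HRe : Re q = R0 * cos b) by (rewrite Hqp; unfold Re, expi; simpl; ring).
  rewrite Hzk.
  assert (0 <= cos b) by (apply cos_ge_0; lra).
  assert (Hcb : cos b <= 1) by apply COS_bound.
  (* If |q| >= 1, then g^k >= 1 and it suffices that cos b >= 1 - h. If |q| < 1, then g^k >= |q|, so
     Re (z^k) >= Re q. *)
  destruct (Rle_or_lt 1 R0) as [h1 | h1].
  - assert (Hg1 : 1 <= g ^ k).
    { apply (pow_ge_min_1 g 1 k (S n)); auto; [lia | lra]. }
    (* If cos b < 1 - h, the squared distance would exceed (R0 - 1)^2 + 2 R0 h >= h^2. *)
    assert (Hcos : 1 - h <= cos b).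
    { assert (Hsq : Cmod (q - 1) ^ 2 = R0 ^ 2 - 2 * R0 * cos b + 1).
      { rewrite Cmod2_alt, Hqp; unfold expi, Re, Im; simpl.
        generalize (sin2_cos2 b); unfold Rsqr; nra. }
      assert (Cmod (q - 1) ^ 2 <= h ^ 2) by (apply pow_incr; split; [apply Cmod_ge_0 | lra]).
      nra. }
    nra.
  - assert (Hg1 : R0 <= g ^ k) by
      (apply (pow_ge_min_1 g R0 k (S n)); auto; [lia | lra | unfold R0; lra]).
    rewrite HRe in Hre.
    apply Rle_trans with (R0 * cos b); [exact Hre |].
    apply Rmult_le_compat; lra.
Qed.

(** * The distinguished root, the size of x, and the initial value t0 *)

Lemma pow_sum_lower (r d : R) :
  0 <= r -> 0 <= d -> r ^ 7 * (r ^ 2 + 9 * r * d + 36 * d ^ 2) <= (r + d) ^ 9.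
Proof.
  intros Hr Hd.
  assert (H : forall i j, 0 <= r ^ i * d ^ j)
    by (intros; apply Rmult_le_pos; apply pow_le; assumption).
  generalize (H 6%nat 3%nat) (H 5%nat 4%nat) (H 4%nat 5%nat) (H 3%nat 6%nat)
    (H 2%nat 7%nat) (H 1%nat 8%nat) (H 0%nat 9%nat).
  intros; apply Rminus_le_0.
  replace ((r + d) ^ 9 - r ^ 7 * (r ^ 2 + 9 * r * d + 36 * d ^ 2)) with
    (84 * (r ^ 6 * d ^ 3) + 126 * (r ^ 5 * d ^ 4) + 126 * (r ^ 4 * d ^ 5)
     + 84 * (r ^ 3 * d ^ 6) + 36 * (r ^ 2 * d ^ 7) + 9 * (r ^ 1 * d ^ 8)
     + r ^ 0 * d ^ 9) by ring.
  lra.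
Qed.

Lemma sqrt2_lower : 1414 / 1000 <= sqrt 2.
Proof. apply (pow_le_inv 1); [apply sqrt_pos | rewrite pow2_sqrt; lra]. Qed.

Section DistinguishedRoot.
Context (xi theta r phi : R).
Context (xi_pos : 0 < xi) (theta_range : 0 <= theta <= PI / 5).
Context (r_pos : 0 < r) (phi_range : 0 <= phi <= theta / 4).
Let u := expi theta.
Let y := (RtoC r * expi (- phi))%C.
Context (y_eq : (y ^ 4 * (y + u))%C = RtoC (2 * xi)).

(** Since y^4 has argument -4 phi and the product y^4 (y + u) is positive, y + u has argument 4
    phi. *)
Lemma y_plus_u_polar : (y + u)%C = (RtoC (2 * xi / r ^ 4) * expi (4 * phi))%C.
Proof.
  assert (E : (expi (4 * phi) * (expi (- phi)) ^ 4)%C = 1).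
  { rewrite expi_pow, <- expi_add, <- expi_0; f_equal; simpl; ring. }
  assert (Hr : RtoC r <> 0) by (intro h; apply RtoC_inj in h; lra).
  unfold Rdiv; rewrite RtoC_mult, <- y_eq, RtoC_inv, RtoC_pow by (apply pow_nonzero; lra).
  unfold y at 2; rewrite Cpow_mult_l.
  transitivity ((y + u) * (expi (4 * phi) * (expi (- phi)) ^ 4))%C.
  - rewrite E; ring.
  - field; exact Hr.
Qed.

Lemma sine_rule : r * sin (5 * phi) = sin (theta - 4 * phi).
Proof.
  assert (H : ((y + u) * expi (- (4 * phi)))%C = RtoC (2 * xi / r ^ 4)).
  { rewrite y_plus_u_polar, <- Cmult_assoc, <- expi_add, Rplus_opp_r, expi_0; ring. }
  unfold y, u in H; rewrite Cmult_plus_distr_r, <- Cmult_assoc, <- !expi_add in H.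
  apply (f_equal Im) in H; unfold expi, Im in H; simpl in H.
  replace (- phi + - (4 * phi)) with (- (5 * phi)) in H by ring.
  rewrite sin_neg in H.
  replace (theta - 4 * phi) with (theta + - (4 * phi)) by ring.
  lra.
Qed.

(** As 5 phi <= 0.8, sin (5 phi) is at least 4.45 phi. With theta < 0.64, the sine rule then gives
    phi (4 + 4.45 r) <= 0.64. *)
Lemma r_phi_bound : r * phi <= 38 / 1000 * (1 + r).
Proof.
  generalize PI_lt_3_2; intro HPI.
  assert (h1 : sin (theta - 4 * phi) <= theta - 4 * phi) by (apply sin_upper; lra).
  assert (h2 : 5 * phi - (5 * phi) ^ 3 / 6 <= sin (5 * phi)) by (apply sin_lower; lra).
  rewrite <- sine_rule in h1.
  assert (h3 : 445 / 100 * phi <= sin (5 * phi)).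
  { assert ((5 * phi) ^ 2 <= (8 / 10) ^ 2) by (apply pow_incr; lra).
    nra. }
  assert (h4 : r * (445 / 100 * phi) <= 64 / 100 - 4 * phi) by nra.
  apply (Rmult_le_reg_r (4 + 445 / 100 * r)); [lra |].
  apply Rle_trans with (64 / 100 * r); [nra |].
  assert (0 <= (r - 948 / 1000) ^ 2) by apply pow2_ge_0.
  nra.
Qed.

Lemma Cmod_y : Cmod y = r.
Proof. apply Cmod_polar; lra. Qed.

(** The range of theta enters here: theta + phi <= 5 theta / 4 <= pi / 4. *)
Lemma cos_theta_phi : sqrt 2 / 2 <= cos (theta + phi).
Proof.
  replace (sqrt 2 / 2) with (cos (PI / 4)).
  - apply cos_decr_1; lra.
  - rewrite cos_PI4; apply (Rmult_eq_reg_r (sqrt 2 * 2)).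
    + generalize (sqrt_def 2 ltac:(lra)) (sqrt_lt_R0 2 ltac:(lra)); intros h h'.
      field_simplify; nra.
    + generalize (sqrt_lt_R0 2 ltac:(lra)); lra.
Qed.

(** Law of cosines: the angle between y and u is theta + phi. *)
Lemma Cmod2_ay_bu (a b : R) :
  Cmod (RtoC a * y + RtoC b * u)%C ^ 2
  = (a * r) ^ 2 + 2 * (a * r) * b * cos (theta + phi) + b ^ 2.
Proof.
  rewrite Cmod2_alt, cos_plus; unfold y, u, expi, Re, Im; simpl.
  rewrite cos_neg, sin_neg.
  generalize (sin2_cos2 theta) (sin2_cos2 phi); unfold Rsqr; intros h1 h2.
  transitivity ((a * r) ^ 2 * (sin phi * sin phi + cos phi * cos phi)
    + 2 * (a * r) * b * (cos theta * cos phi - sin theta * sin phi)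
    + b ^ 2 * (sin theta * sin theta + cos theta * cos theta)); [ring |].
  rewrite h1, h2; ring.
Qed.

Let alpha := sqrt ((2 + sqrt 2) / 4).
Let x := Rpower (xi / alpha) (2 / 9).

Lemma x_pow9 : x ^ 9 = r ^ 8 * Cmod (y + u) ^ 2 / (2 + sqrt 2).
Proof.
  generalize (sqrt_pos 2); intro Hs.
  assert (Ha : 0 < alpha) by (apply sqrt_lt_R0; lra).
  assert (Ha2 : alpha ^ 2 = (2 + sqrt 2) / 4) by (unfold alpha; rewrite pow2_sqrt; lra).
  assert (Hx : x ^ 9 = (xi / alpha) ^ 2).
  { unfold x; rewrite <- Rpower_pow by apply exp_pos; rewrite Rpower_mult.
    replace (2 / 9 * INR 9) with (INR 2) by (simpl; field).
    apply Rpower_pow; now apply Rdiv_lt_0_compat. }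
  assert (Hr : 0 < r ^ 4) by now apply pow_lt.
  rewrite Hx, y_plus_u_polar, Cmod_polar2.
  replace ((xi / alpha) ^ 2) with (xi ^ 2 / alpha ^ 2) by (field; lra).
  rewrite Ha2; field; repeat split; lra.
Qed.

(** By the law of cosines |y + u|^2 >= r^2 + sqrt 2 r + 1 >= (2 + sqrt 2) r, the last step being (r
    - 1)^2 >= 0. The constant [alpha] is adjusted to this minimum. *)
Lemma x_lower : r <= x.
Proof.
  generalize sqrt2_lower cos_theta_phi; intros Hs Hc.
  apply (pow_le_inv 8); [left; apply exp_pos |].
  rewrite x_pow9.
  generalize (Cmod2_ay_bu 1 1); rewrite !Cmult_1_l; intros ->.
  assert (Hr8 : 0 < r ^ 8) by now apply pow_lt.
  apply (Rmult_le_reg_r (2 + sqrt 2)); [lra |].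
  replace (r ^ 8 * ((1 * r) ^ 2 + 2 * (1 * r) * 1 * cos (theta + phi) + 1 ^ 2)
    / (2 + sqrt 2) * (2 + sqrt 2))
    with (r ^ 8 * ((1 * r) ^ 2 + 2 * (1 * r) * 1 * cos (theta + phi) + 1 ^ 2))
    by (field; lra).
  replace (r ^ 9 * (2 + sqrt 2)) with (r ^ 8 * (r * (2 + sqrt 2))) by ring.
  apply Rmult_le_compat_l; [lra |].
  assert (0 <= (r - 1) ^ 2) by apply pow2_ge_0.
  nra.
Qed.

(* The hypothesis keeps only the three leading terms of the binomial expansion of
   [(r + c (1 + r)) ^ 9]; 0.293 is an upper bound for [1 / (2 + sqrt 2)]. *)
Lemma x_upper (c : R) :
  0 <= c ->
  293 / 1000 * r * (1 + r) ^ 2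
  <= r ^ 2 + 9 * r * (c * (1 + r)) + 36 * (c * (1 + r)) ^ 2 ->
  x <= r + c * (1 + r).
Proof.
  intros Hc H.
  generalize sqrt2_lower; intros Hs.
  apply (pow_le_inv 8); [nra |].
  rewrite x_pow9.
  eapply Rle_trans; [| apply pow_sum_lower; nra].
  assert (HL : Cmod (y + u) ^ 2 <= (1 + r) ^ 2).
  { apply pow_incr; split; [apply Cmod_ge_0 |].
    eapply Rle_trans; [apply Cmod_triangle |].
    unfold u; rewrite Cmod_y, Cmod_expi; lra. }
  assert (Hr7 : 0 < r ^ 7) by now apply pow_lt.
  assert (Hi : / (2 + sqrt 2) <= 293 / 1000).
  { replace (293 / 1000) with (/ (1000 / 293)) by field; apply Rinv_le_contravar; lra. }
  assert (Hi0 : 0 < / (2 + sqrt 2)) by (apply Rinv_0_lt_compat; lra).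
  replace (r ^ 8 * Cmod (y + u) ^ 2 / (2 + sqrt 2))
    with (r ^ 7 * (/ (2 + sqrt 2) * (r * Cmod (y + u) ^ 2))) by (field; lra).
  apply Rmult_le_compat_l; [lra |].
  eapply Rle_trans; [| exact H].
  rewrite Rmult_assoc.
  apply Rmult_le_compat; [lra | | exact Hi |].
  - apply Rmult_le_pos; [lra | apply pow_le, Cmod_ge_0].
  - apply Rmult_le_compat_l; lra.
Qed.

Lemma Re_u_plus_x : 0 < Re (u + RtoC x).
Proof.
  assert (0 < x) by apply exp_pos.
  assert (0 < cos theta) by (generalize PI_gt_3; intro; apply cos_gt_0; lra).
  unfold u, expi, Re; simpl; lra.
Qed.

(** From 4 x <= (1 + x)^2 follows |u + x|^2 >= (1 + x)^2 (1 + cos theta) / 2; the factor 0.947 is a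
    lower bound for cos (theta / 2). *)
Lemma Cmod_u_plus_x : 947 / 1000 * (1 + r) <= Cmod (u + RtoC x).
Proof.
  generalize PI_lt_3_2 x_lower; intros HPI Hx.
  assert (Hc : 1 - theta ^ 2 / 2 <= cos theta) by (apply cos_lower; lra).
  assert (theta ^ 2 <= (64 / 100) ^ 2) by (apply pow_incr; lra).
  apply (pow_le_inv 1); [apply Cmod_ge_0 |].
  apply Rle_trans with ((947 / 1000 * (1 + x)) ^ 2); [apply pow_incr; lra |].
  rewrite Cmod2_alt; unfold u, expi, Re, Im; simpl.
  generalize (sin2_cos2 theta); unfold Rsqr; intro h1.
  assert (h2 : 0 <= (1 - x) ^ 2) by apply pow2_ge_0.
  nra.
Qed.

Lemma y_minus_x (c : R) :
  x <= r + c * (1 + r) -> Cmod (y - RtoC x) <= (c + 38 / 1000) * (1 + r).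
Proof.
  intros Hx.
  generalize r_phi_bound x_lower PI_lt_3_2; intros Hp Hl HPI.
  replace (y - RtoC x)%C with (RtoC r * (expi (- phi) - 1) + RtoC (r - x))%C
    by (unfold y; rewrite RtoC_minus; ring).
  eapply Rle_trans; [apply Cmod_triangle |].
  rewrite Cmod_mult, !Cmod_R, (Rabs_pos_eq r), (Rabs_left1 (r - x)) by lra.
  assert (He : Cmod (expi (- phi) - 1) <= phi).
  { rewrite <- Cmod_conj.
    replace (Cconj (expi (- phi) - 1)) with (expi phi - 1)%C.
    - apply expi_minus_1; lra.
    - apply C_eq; unfold expi, Cconj, Re, Im; simpl;
        rewrite ?cos_neg, ?sin_neg; ring. }
  nra.
Qed.

(** Here 2 xi / (u + x) = y^4 (y + u) / (u + x). The sector condition holds because |a| < pi / 8 and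
    phi <= pi / 20. *)
Lemma fourth_root_of_quotient (g a : R) :
  0 < g -> - (PI / 2) < 4 * a < PI / 2 ->
  ((RtoC g * expi a) ^ 4)%C = ((y + u) / (u + RtoC x))%C ->
  nth_root 4 (RtoC (2 * xi) / (u + RtoC x))%C = (y * (RtoC g * expi a))%C.
Proof.
  intros Hg Ha Hz.
  generalize Re_u_plus_x; intro Hux.
  apply nth_root_eq; [lia |]; split.
  - rewrite Cpow_mult_l, Hz, <- y_eq; field.
    intro h; rewrite h in Hux; unfold Re in Hux; simpl in Hux; lra.
  - exists (r * g), (- phi + a); split; [nra | split].
    + generalize PI_gt_3; simpl; lra.
    + rewrite expi_add, RtoC_mult; unfold y; ring.
Qed.

(** The quotient (y + u) / (u + x) differs from 1 by (y - x) / (u + x), of modulus at most h = (c +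
    0.038) / 0.947; its fourth root gains the factor 1 + 3 (1 - h). *)
Lemma initial_error_near (c : R) :
  0 <= c <= 6 / 100 ->
  293 / 1000 * r * (1 + r) ^ 2
  <= r ^ 2 + 9 * r * (c * (1 + r)) + 36 * (c * (1 + r)) ^ 2 ->
  exists z, nth_root 4 (RtoC (2 * xi) / (u + RtoC x))%C = (y * z)%C /\
    Cmod (z - 1) * (4 - 3 * ((c + 38 / 1000) / (947 / 1000)))
    <= (c + 38 / 1000) / (947 / 1000).
Proof.
  intros Hc H.
  set (h := (c + 38 / 1000) / (947 / 1000)).
  assert (Hxy := y_minus_x c (x_upper c (proj1 Hc) H)).
  generalize Cmod_u_plus_x Re_u_plus_x; intros Hn Hre.
  assert (Hnz : (u + RtoC x)%C <> 0).
  { intro h0; rewrite h0 in Hre; unfold Re in Hre; simpl in Hre; lra. }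
  assert (Hq : Cmod ((y + u) / (u + RtoC x) - 1) <= h).
  { replace ((y + u) / (u + RtoC x) - 1)%C with ((y - RtoC x) / (u + RtoC x))%C
      by (field; exact Hnz).
    rewrite Cmod_div by exact Hnz.
    apply Rle_div_l; [nra |]; unfold h; nra. }
  destruct (principal_root_near_1 3 _ h ltac:(unfold h; lra) Hq) as (g & a & Hg & Ha & Hz & Hm).
  exists (RtoC g * expi a)%C; split.
  - apply fourth_root_of_quotient; auto; simpl in Ha; lra.
  - eapply Rle_trans; [| exact Hq]; eapply Rle_trans; [| exact Hm].
    apply Req_le; simpl; ring.
Qed.

(** A crude estimate for large r: the quotient has modulus at most 1 / 0.947 and positive real part,
    so |z - 1|^2 <= |z|^2 + 1. *)
Lemma initial_error_far :
  exists z, nth_root 4 (RtoC (2 * xi) / (u + RtoC x))%C = (y * z)%C /\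
    Cmod z <= 1056 / 1000 /\ Cmod (z - 1) <= 1455 / 1000.
Proof.
  generalize Cmod_u_plus_x Re_u_plus_x; intros Hn Hre.
  assert (Hnz : (u + RtoC x)%C <> 0).
  { intro h0; rewrite h0 in Hre; unfold Re in Hre; simpl in Hre; lra. }
  assert (Hq : Cmod ((y + u) / (u + RtoC x)) <= 1056 / 1000).
  { rewrite Cmod_div by exact Hnz.
    apply Rle_div_l; [nra |].
    apply Rle_trans with (1 + r); [| lra].
    eapply Rle_trans; [apply Cmod_triangle |].
    unfold u; rewrite Cmod_y, Cmod_expi; lra. }
  assert (Hqre : 0 < Re ((y + u) / (u + RtoC x))%C).
  { assert (Hs : 0 < Re (u + RtoC x) ^ 2 + Im (u + RtoC x) ^ 2) by nra.
    assert (Hx : 0 < x) by apply exp_pos.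
    assert (Hk : 0 < 2 * xi / r ^ 4) by (apply Rdiv_lt_0_compat; [lra | now apply pow_lt]).
    assert (Hc1 : 0 < cos (4 * phi - theta)) by (generalize PI_gt_3; intro; apply cos_gt_0; lra).
    assert (Hc2 : 0 < cos (4 * phi)) by (generalize PI_gt_3; intro; apply cos_gt_0; lra).
    replace (Re ((y + u) / (u + RtoC x))%C) with
      (2 * xi / r ^ 4 * (cos (4 * phi - theta) + x * cos (4 * phi))
       / (Re (u + RtoC x) ^ 2 + Im (u + RtoC x) ^ 2)).
    - apply Rdiv_lt_0_compat; [apply Rmult_lt_0_compat; [exact Hk | nra] | exact Hs].
    - rewrite y_plus_u_polar, cos_minus.
      unfold u, expi, Re, Im in *; simpl in *; field; repeat split; lra. }
  destruct (principal_root 3 _ Hqre) as (g & a & Hg & Ha & Hz & Hm).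
  simpl INR in Ha.
  exists (RtoC g * expi a)%C; split; [| split].
  - apply fourth_root_of_quotient; auto; lra.
  - rewrite Cmod_polar by lra.
    apply (pow_le_inv 3); [lra |]; lra.
  - assert (Hc : 0 <= cos a) by (generalize PI_gt_3; intro; apply cos_ge_0; lra).
    assert (Hg' : g <= 1056 / 1000) by (apply (pow_le_inv 3); lra).
    apply (pow_le_inv 1); [lra |].
    rewrite Cmod2_alt; unfold expi, Re, Im; simpl.
    generalize (sin2_cos2 a); unfold Rsqr; nra.
Qed.

End DistinguishedRoot.

(** * Existence and polar form of the distinguished root *)

Lemma ystar_exists (xi theta : R) :
  0 < xi -> 0 <= theta <= PI / 5 -> exists y, is_ystar xi theta y.
Proof.
  intros Hxi Ht.
  destruct (proj1 Ht) as [Hpos | <-].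
  (* The sine rule gives r = sin (theta - 4 p) / sin (5 p) and |y + u| = sin (theta + p) / sin (5
     p); then r^4 |y + u| = 2 xi becomes f p = 0. *)
  - pose (f := fun p => 2 * xi * sin (5 * p) ^ 5
      - sin (theta - 4 * p) ^ 4 * sin (theta + p)).
    assert (Hcont : continuity f) by (unfold f; reg).
    assert (Hf0 : f 0 < 0).
    { unfold f; rewrite !Rmult_0_r, sin_0, Rminus_0_r, Rplus_0_r.
      assert (0 < sin theta ^ 5) by (apply pow_lt, sin_gt_0; lra).
      nra. }
    assert (Hf1 : 0 < f (theta / 4)).
    { unfold f; replace (theta - 4 * (theta / 4)) with 0 by field; rewrite sin_0.
      assert (0 < sin (5 * (theta / 4)) ^ 5) by (apply pow_lt, sin_gt_0; lra).
      nra. }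
    destruct (IVT f 0 (theta / 4) Hcont ltac:(lra) Hf0 Hf1) as (p & Hp & Hfp).
    (* An interior p makes both sines below positive and puts -p in the half-open sector. *)
    assert (p <> 0) by (intro; subst p; lra).
    assert (p <> theta / 4) by (intro; subst p; lra).
    assert (Hs5 : 0 < sin (5 * p)) by (apply sin_gt_0; lra).
    assert (Hs4 : 0 < sin (theta - 4 * p)) by (apply sin_gt_0; lra).
    set (r := sin (theta - 4 * p) / sin (5 * p)).
    assert (Hr : 0 < r) by now apply Rdiv_lt_0_compat.
    exists (RtoC r * expi (- p))%C; split; [| split]; [| | intro; lra].
    + assert (Hsum : (RtoC r * expi (- p) + expi theta)%C
        = (RtoC (sin (theta + p) / sin (5 * p)) * expi (4 * p))%C).
      { assert (E : forall z w : C, (RtoC (sin (5 * p)) * z = RtoC (sin (5 * p)) * w)%C -> z = w).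
        { intros z w H1.
          assert (Hn : RtoC (sin (5 * p)) <> 0) by (intro h; apply RtoC_inj in h; lra).
          rewrite <- (Cmult_1_l z), <- (Cmult_1_l w), <- (Cinv_l _ Hn), <- !Cmult_assoc, H1.
          reflexivity. }
        apply E; rewrite Cmult_plus_distr_l, !Cmult_assoc, <- !RtoC_mult.
        replace (sin (5 * p) * r) with (sin (theta - 4 * p)) by (unfold r; field; lra).
        replace (sin (5 * p) * (sin (theta + p) / sin (5 * p))) with (sin (theta + p))
          by (field; lra).
        replace (5 * p) with (4 * p + p) by ring.
        apply C_eq; unfold expi, Re, Im; simpl;
          rewrite ?cos_neg, ?sin_neg, sin_minus, (sin_plus (4 * p) p), (sin_plus theta p);
          ring. }
      transitivity ((RtoC r * expi (- p)) ^ 4 * (RtoC r * expi (- p) + expi theta) / 2)%C;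
        [field |].
      rewrite Hsum, Cpow_mult_l, expi_pow.
      replace (INR 4 * - p) with (- (4 * p)) by (simpl; ring).
      transitivity (RtoC r ^ 4 * RtoC (sin (theta + p) / sin (5 * p)) / 2
        * (expi (- (4 * p)) * expi (4 * p)))%C; [field |].
      rewrite <- expi_add, Rplus_opp_l, expi_0, <- RtoC_pow, <- RtoC_mult.
      rewrite <- RtoC_div, <- RtoC_mult by lra; f_equal.
      unfold f in Hfp; unfold r.
      apply (Rmult_eq_reg_r (2 * sin (5 * p) ^ 5));
        [| apply Rgt_not_eq; assert (0 < sin (5 * p) ^ 5) by (now apply pow_lt); lra].
      transitivity (sin (theta - 4 * p) ^ 4 * sin (theta + p)); [field; lra | lra].
    + intros _; exists r, (- p); split; [exact Hr | split; [lra | reflexivity]].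
  - pose (f := fun r => r ^ 5 + r ^ 4 - 2 * xi).
    assert (Hcont : continuity f) by (unfold f; reg).
    assert (Hf1 : 0 < f (1 + 2 * xi)).
    { unfold f.
      assert (1 <= (1 + 2 * xi) ^ 4) by (apply pow_R1_Rle; lra).
      replace ((1 + 2 * xi) ^ 5) with ((1 + 2 * xi) * (1 + 2 * xi) ^ 4) by ring.
      nra. }
    assert (Hf0 : f 0 < 0) by (unfold f; simpl; lra).
    destruct (IVT f 0 (1 + 2 * xi) Hcont ltac:(lra) Hf0 Hf1) as (r & Hr & Hfr).
    assert (r <> 0) by (intro; subst r; lra).
    exists (RtoC r); split; [| split]; [| intro; lra | intros _; exists r; split; [lra | reflexivity]].
    rewrite expi_0, Cmult_1_l, <- !RtoC_pow, <- RtoC_plus, <- RtoC_div by lra; f_equal.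
    unfold f in Hfr; lra.
Qed.

(** Both clauses of the definition merge: the case theta = 0 is phi = 0. *)
Lemma is_ystar_polar (xi theta : R) (y : C) :
  0 <= theta -> is_ystar xi theta y ->
  exists r phi, 0 < r /\ 0 <= phi <= theta / 4 /\ y = (RtoC r * expi (- phi))%C /\
    (y ^ 4 * (y + expi theta))%C = RtoC (2 * xi).
Proof.
  intros Ht (E & H1 & H2).
  assert (E' : (y ^ 4 * (y + expi theta))%C = RtoC (2 * xi)).
  { rewrite RtoC_mult, <- E; field. }
  destruct Ht as [Ht | <-].
  - destruct (H1 Ht) as (r & s & Hr & Hs & Hy).
    exists r, (- s); rewrite Ropp_involutive; repeat split; auto; lra.
  - destruct (H2 eq_refl) as (r & Hr & Hy).
    exists r, 0; repeat split; auto; try lra.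
    rewrite Ropp_0, expi_0, Cmult_1_r; exact Hy.
Qed.

(** * The error of t0, weighted for its effect on the radicand *)

(* For t = y z, bounds 125 |g t - g y| / (|y| |z - 1|), with rho = 5 |y| and m = |z|. *)
Definition increment_bound (rho m : R) : R :=
  2 * rho ^ 2 * (1 + m + m ^ 2) + 2 * rho * (1 + m) + 1.

(** For r <= 1/2 the right side can be close to 21/1000, which calls for the sharper c = 0.02; c =
    0.06 serves up to r = 4. Beyond, the fourth power of 5 r outweighs the quadratic
    [increment_bound] even with the crude error. *)
Lemma initial_error (xi theta r phi : R) :
  0 < xi -> 0 <= theta <= PI / 5 -> 0 < r -> 0 <= phi <= theta / 4 ->
  let u := expi theta in
  let y := (RtoC r * expi (- phi))%C in
  (y ^ 4 * (y + u))%C = RtoC (2 * xi) ->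
  exists z,
    nth_root 4 (RtoC (2 * xi)
      / (u + RtoC (Rpower (xi / sqrt ((2 + sqrt 2) / 4)) (2 / 9))))%C = (y * z)%C /\
    Cmod (z - 1) * increment_bound (5 * r) (Cmod z)
    <= 21 / 1000 * (1 + 1414 / 1000 * (5 * r) + (5 * r) ^ 2) ^ 2.
Proof.
  intros Hxi Ht Hr Hp u y Hy.
  assert (Htri : forall z, Cmod z <= 1 + Cmod (z - 1)).
  { intros z; rewrite <- Cmod_1 at 1.
    eapply Rle_trans; [| apply Cmod_triangle]; apply Req_le; f_equal; ring. }
  assert (Hmono : forall z t m, Cmod (z - 1) <= t -> Cmod z <= m ->
    Cmod (z - 1) * increment_bound (5 * r) (Cmod z) <= t * increment_bound (5 * r) m).
  { intros z t m H1 H2; unfold increment_bound.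
    generalize (Cmod_ge_0 z) (Cmod_ge_0 (z - 1)); intros H3 H4.
    assert (Cmod z ^ 2 <= m ^ 2) by (apply pow_incr; lra).
    assert (0 <= Cmod z ^ 2) by now apply pow_le.
    assert (0 <= 2 * (5 * r) ^ 2) by (generalize (pow2_ge_0 (5 * r)); lra).
    apply Rmult_le_compat; [exact H4 | | exact H1 |].
    - apply Rplus_le_le_0_compat; [| lra].
      apply Rplus_le_le_0_compat; apply Rmult_le_pos; lra.
    - apply Rplus_le_compat_r, Rplus_le_compat; apply Rmult_le_compat_l; lra. }
  destruct (Rle_or_lt r (1 / 2)) as [Hr1 | Hr1]; [| destruct (Rle_or_lt r 4) as [Hr2 | Hr2]].
  - destruct (initial_error_near xi theta r phi Hxi Ht Hr Hp Hy (2 / 100) ltac:(lra)) as (z & Hz & Hm).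
    { assert (r ^ 3 <= 1 / 2 * r ^ 2) by nra.
      (* After r^3 is replaced by r^2 / 2, the quadratic that remains is smallest near r = 0.09. *)
      assert (0 <= (r - 9 / 100) ^ 2) by apply pow2_ge_0.
      nra. }
    exists z; split; [exact Hz |].
    (* This constant, like 283/10000 below, bounds h / (4 - 3 h) with h = (c + 0.038) / 0.947. *)
    assert (Hz1 : Cmod (z - 1) <= 163 / 10000) by lra.
    eapply Rle_trans; [apply (Hmono z (163 / 10000) (10163 / 10000) Hz1); specialize (Htri z); lra |].
    unfold increment_bound; set (rho := 5 * r).
    assert (0 < rho) by (unfold rho; lra).
    (* The two sides are closest near rho = 0.3; squares centred near there make the inequality
       linear in the powers of rho. *)
    assert (0 <= rho * (rho - 35 / 100) ^ 2) by (apply Rmult_le_pos; [lra | apply pow2_ge_0]).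
    assert (0 <= (rho - 3 / 10) ^ 2) by apply pow2_ge_0.
    assert (0 < rho ^ 4) by now apply pow_lt.
    lra.
  - destruct (initial_error_near xi theta r phi Hxi Ht Hr Hp Hy (6 / 100) ltac:(lra)) as (z & Hz & Hm).
    { assert (r ^ 3 <= 4 * r ^ 2) by nra.
      nra. }
    exists z; split; [exact Hz |].
    assert (Hz1 : Cmod (z - 1) <= 283 / 10000) by lra.
    eapply Rle_trans; [apply (Hmono z (283 / 10000) (10283 / 10000) Hz1); specialize (Htri z); lra |].
    unfold increment_bound; set (rho := 5 * r).
    assert (25 / 10 < rho) by (unfold rho; lra).
    assert (25 / 10 * rho <= rho ^ 2) by nra.
    assert (25 / 10 * rho ^ 2 <= rho ^ 3) by nra.
    assert (25 / 10 * rho ^ 3 <= rho ^ 4) by nra.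
    lra.
  - destruct (initial_error_far xi theta r phi Hxi Ht Hr Hp Hy) as (z & Hz & Hm & Hz1).
    exists z; split; [exact Hz |].
    eapply Rle_trans; [apply (Hmono z _ _ Hz1 Hm) |].
    unfold increment_bound; set (rho := 5 * r).
    (* The margin at rho = 20 is small, hence the threshold r = 4. *)
    assert (20 < rho) by (unfold rho; lra).
    assert (20 * rho <= rho ^ 2) by nra.
    assert (20 * rho ^ 2 <= rho ^ 3) by nra.
    assert (20 * rho ^ 3 <= rho ^ 4) by nra.
    lra.
Qed.

(** * The fifth root and the final bound *)

(** The radicand is V^5 + D with |D| <= 0.105 r |V|^4. The fifth root of 1 + D / V^5 gains the
    factor 1 + 4 (1 - 0.105) = 4.58, so the relative error is at most 0.105 / 4.58 < 0.0251. *)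
Lemma fifth_root_perturbation (theta r phi : R) (z : C) :
  0 <= theta <= PI / 5 -> 0 < r -> 0 <= phi <= theta / 4 ->
  let u := expi theta in
  let y := (RtoC r * expi (- phi))%C in
  let t := (y * z)%C in
  Cmod (z - 1) * increment_bound (5 * r) (Cmod z)
    <= 21 / 1000 * (1 + 1414 / 1000 * (5 * r) + (5 * r) ^ 2) ^ 2 ->
  Cmod ((nth_root 5 (y ^ 4 * (y + u)
                 + RtoC 2 * u ^ 2 / RtoC 5 * t ^ 3
                 + RtoC 2 * u ^ 3 / RtoC 25 * t ^ 2
                 + u ^ 4 / RtoC 125 * t
                 + u ^ 5 / RtoC 3125)
     - u / RtoC 5) / y - RtoC 1)%C <= 251 / 10000.
Proof.
  intros Ht Hr Hp u y t Hz.
  assert (Hy : Cmod y = r) by (apply Cmod_polar; lra).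
  assert (Hu : Cmod u = 1) by apply Cmod_expi.
  assert (Hy0 : y <> 0) by (apply Cmod_gt_0; lra).
  set (V := (y + u / RtoC 5)%C).
  set (N2 := 1 + 1414 / 1000 * (5 * r) + (5 * r) ^ 2) in *.
  assert (HV : N2 <= 25 * Cmod V ^ 2).
  { replace V with (RtoC 1 * y + RtoC (/ 5) * u)%C.
    - unfold u, y; rewrite Cmod2_ay_bu.
      generalize (cos_theta_phi theta phi Ht Hp) sqrt2_lower; unfold N2; intros; nra.
    - unfold V; rewrite RtoC_inv by lra; field. }
  assert (HVr : r <= Cmod V).
  { apply (pow_le_inv 1); [apply Cmod_ge_0 |]; unfold N2 in HV; nra. }
  assert (HV0 : V <> 0) by (apply Cmod_gt_0; lra).
  (* D is g t - g y, with y (z - 1) factored out of each difference t^k - y^k. *)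
  set (D := (y * (z - 1) * (RtoC 2 * u ^ 2 / RtoC 5 * y ^ 2 * (1 + z + z ^ 2)
    + RtoC 2 * u ^ 3 / RtoC 25 * y * (1 + z) + u ^ 4 / RtoC 125))%C).
  match goal with |- context [nth_root 5 ?w] => set (W := w) end.
  assert (HW : W = (V ^ 5 + D)%C).
  { unfold W, D, V, t; field. }
  (* 105/1000 is 21/1000 times 625 / 125: 625 comes from (25 |V|^2)^2, 125 from the scaling of
     [increment_bound]. *)
  assert (HD : Cmod D <= 105 / 1000 * r * Cmod V ^ 4).
  { assert (HB : Cmod D <= r * Cmod (z - 1) * (increment_bound (5 * r) (Cmod z) / 125)).
    { unfold D; rewrite !Cmod_mult, Hy.
      apply Rmult_le_compat_l.
      { apply Rmult_le_pos; [lra | apply Cmod_ge_0]. }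
      replace (RtoC 2 * u ^ 2 / RtoC 5 * y ^ 2 * (1 + z + z ^ 2)
        + RtoC 2 * u ^ 3 / RtoC 25 * y * (1 + z) + u ^ 4 / RtoC 125)%C
        with (RtoC (2 / 5) * u ^ 2 * y ^ 2 * (1 + z + z ^ 2)
        + RtoC (2 / 25) * u ^ 3 * y * (1 + z) + RtoC (1 / 125) * u ^ 4)%C
        by (rewrite !RtoC_div by lra; field).
      assert (H1 : Cmod (1 + z) <= 1 + Cmod z).
      { rewrite <- Cmod_1 at 2; apply Cmod_triangle. }
      assert (H2 : Cmod (1 + z + z ^ 2) <= 1 + Cmod z + Cmod z ^ 2).
      { rewrite <- Cmod_pow; generalize (Cmod_triangle (1 + z) (z ^ 2)); lra. }
      eapply Rle_trans; [apply Cmod_triangle |].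
      eapply Rle_trans; [apply Rplus_le_compat_r, Cmod_triangle |].
      rewrite !Cmod_mult, !Cmod_pow, !Cmod_R, Hy, Hu, !pow1, !Rabs_pos_eq by lra.
      apply (Rmult_le_compat_l (2 / 5 * r ^ 2)) in H2;
        [| generalize (pow2_ge_0 r); lra].
      apply (Rmult_le_compat_l (2 / 25 * r)) in H1; [| lra].
      unfold increment_bound; lra. }
    apply (Rle_trans _ _ _ HB).
    assert (N2 ^ 2 <= (25 * Cmod V ^ 2) ^ 2) by (apply pow_incr; split; [unfold N2; nra | exact HV]).
    apply Rle_trans with (r / 125 * (21 / 1000 * N2 ^ 2)); [| nra].
    replace (r * Cmod (z - 1) * (increment_bound (5 * r) (Cmod z) / 125))
      with (r / 125 * (Cmod (z - 1) * increment_bound (5 * r) (Cmod z))) by field.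
    apply Rmult_le_compat_l; lra. }
  assert (Hq : Cmod (W / V ^ 5 - 1) * Cmod V <= 105 / 1000 * r).
  { replace (W / V ^ 5 - 1)%C with (D / V ^ 5)%C by (rewrite HW; field; exact HV0).
    rewrite Cmod_div, Cmod_pow by (now apply Cpow_nz).
    assert (HV4 : 0 < Cmod V ^ 4) by (apply pow_lt; lra).
    apply (Rmult_le_reg_r (Cmod V ^ 4)); [exact HV4 |].
    replace (Cmod D / Cmod V ^ 5 * Cmod V * Cmod V ^ 4) with (Cmod D) by (field; lra).
    exact HD. }
  assert (Hq' : Cmod (W / V ^ 5 - 1) <= 105 / 1000).
  { generalize (Cmod_ge_0 (W / V ^ 5 - 1)); nra. }
  destruct (principal_root_near_1 4 _ (105 / 1000) ltac:(lra) Hq') as (g & a & Hg & Ha & Hz5 & Hm).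
  set (z5 := (RtoC g * expi a)%C) in *.
  set (e := (V * (z5 - 1) / y)%C).
  assert (He : Cmod e <= 251 / 10000).
  { unfold e; rewrite Cmod_div, Cmod_mult, Hy by exact Hy0.
    apply Rle_div_l; [lra |].
    simpl INR in Hm.
    generalize (Cmod_ge_0 V); nra. }
  assert (HVz : (V * z5)%C = (u / RtoC 5 + y * (1 + e))%C).
  { unfold e, V; field; exact Hy0. }
  rewrite (nth_root_eq 5 W (V * z5)%C); [| lia |].
  - replace ((V * z5 - u / RtoC 5) / y - RtoC 1)%C with e; [exact He |].
    rewrite HVz; field; exact Hy0.
  - split.
    + rewrite Cpow_mult_l, Hz5; field; exact HV0.
    (* It remains to place V z5 = u/5 + y (1 + e) in the sector. Multiplying by [expi b] does not
       change |e|, so e moves each imaginary part by at most 0.0251 r. *)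
    + assert (HIme : forall b, - (251 / 10000) <= Im (expi (b - phi) * e) <= 251 / 10000).
      { intros b; assert (h := Im_le_Cmod (expi (b - phi) * e)).
        rewrite Cmod_mult, Cmod_expi in h; lra. }
      assert (HIm : forall b, Im ((u / RtoC 5 + y * (1 + e)) * expi b)
        = sin (theta + b) / 5 + r * (sin (b - phi) + Im (expi (b - phi) * e))).
      { intros b.
        replace ((u / RtoC 5 + y * (1 + e)) * expi b)%C
          with (RtoC (/ 5) * expi (theta + b)
            + RtoC r * (expi (b - phi) + expi (b - phi) * e))%C.
        - generalize (expi (b - phi) * e)%C; intros c; unfold Im, expi; simpl; field.
        - unfold Rminus, u, y; rewrite !expi_add, RtoC_inv by lra; field. }
      generalize PI_lt_3_2 PI_gt_3; intros HPI1 HPI2.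
      destruct (sector_polar (PI / 5) (V * z5)) as (R0 & s & HR & Hs & E).
      * lra.
      * rewrite HVz, HIm.
        generalize (HIme (PI / 5)); intro.
        assert (0 <= sin (theta + PI / 5)) by (apply sin_ge_0; lra).
        assert (h2 := sin_lower (PI / 5 - phi) ltac:(lra)).
        assert ((PI / 5 - phi) ^ 2 <= 1 ^ 2) by (apply pow_incr; lra).
        assert (1 / 4 <= sin (PI / 5 - phi)) by nra.
        nra.
      * rewrite HVz, HIm.
        generalize (HIme (- (PI / 5))); intro.
        (* This sine vanishes at theta = pi/5; strictness comes from the term in r, since sin (pi/5
           + phi) >= 1/4 > 0.0251. *)
        assert (0 <= sin (PI / 5 - theta)) by (apply sin_ge_0; lra).
        assert (h2 := sin_lower (PI / 5 + phi) ltac:(lra)).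
        assert ((PI / 5 + phi) ^ 2 <= 1 ^ 2) by (apply pow_incr; lra).
        assert (1 / 4 <= sin (PI / 5 + phi)) by nra.
        replace (theta + - (PI / 5)) with (- (PI / 5 - theta)) by ring.
        replace (- (PI / 5) - phi) with (- (PI / 5 + phi)) in * by ring.
        rewrite !sin_neg in *; nra.
      * exists R0, s; split; [lra | split; [| exact E]]. simpl; lra.
Qed.

Theorem theorem2 :
  forall xi theta : R, 0 < xi -> 0 <= theta <= PI / 5 ->
  let u : C := expi theta in
  let alpha : R := sqrt ((2 + sqrt 2) / 4) in
  let t0 : C :=
    nth_root 4 (RtoC (2 * xi) / (u + RtoC (Rpower (xi / alpha) (2 / 9))))%C in
  let y1 : C :=
    (nth_root 5 (RtoC (2 * xi)
                 + RtoC 2 * u ^ 2 / RtoC 5 * t0 ^ 3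
                 + RtoC 2 * u ^ 3 / RtoC 25 * t0 ^ 2
                 + u ^ 4 / RtoC 125 * t0
                 + u ^ 5 / RtoC 3125)
     - u / RtoC 5)%C in
  Cmod (y1 / ystar xi theta - RtoC 1)%C <= 251 / 10000.
Proof.
  intros xi theta Hxi Ht u alpha t0 y1; unfold y1.
  assert (Hy : is_ystar xi theta (ystar xi theta)).
  { unfold ystar; apply epsilon_spec; now apply ystar_exists. }
  destruct (is_ystar_polar _ _ _ (proj1 Ht) Hy) as (r & phi & Hr & Hp & -> & E).
  destruct (initial_error xi theta r phi Hxi Ht Hr Hp E) as (z & Hz & Hb).
  (* Writing 2 xi as y^4 (y + u) exposes the radicand as a perturbation of V^5. *)
  unfold t0, alpha, u; rewrite Hz, <- E.
  now apply fifth_root_perturbation.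
Qed.
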